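(* Let $G$ be a simple connected undirected graph with vertices $v_1,\dots,v_n$, $n\ge 2$, and Laplacian matrix $L$. Let $\gamma_1\ge\cdots\ge\gamma_{n-1}\ge\gamma_n=0$ be the eigenvalues of $L$, and let $S_i=(s_{i1},\dots,s_{in})^T$, $1\le i\le n$, be real, normalized, mutually orthogonal eigenvectors of $L$, with $S_i$ corresponding to $\gamma_i$. Then $G$ is resistance regular if and only if the quantity $$\frac{1}{\deg_G(v_i)}\left(\sum_{v_j\in N(v_i)}\left(\sum_{k=1}^{n-1}\frac{1}{\gamma_k}s_{ki}s_{kj}\right)+1-\frac1n\right)$$ is the same for every $i\in\{1,2,\dots,n\}$.
   Context: $\deg_G(v_i)$ is the degree of $v_i$ and $N(v_i)$ is the set of neighbors of $v_i$. The Laplacian matrix is $L=D-A$, where $A$ is the adjacency matrix and $D$ the diagonal matrix of vertex degrees. With $L^\dagger=(l^\dagger_{ij})$ the Moore-Penrose inverse of $L$, the resistance distance between $v_i$ and $v_j$ is $r_{ij}=l^\dagger_{ii}+l^\dagger_{jj}-2l^\dagger_{ij}$. The resistance distance matrix is $R(G)=(r_{ij})_{n\times n}$, and $R_i=\sum_{j=1}^n r_{ij}$ is the resistance degree of $v_i$. $G$ is resistance regular if all $R_i$ are equal. *)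

(* Defs.v *)
From HB Require Import structures.
From mathcomp Require Import all_boot all_order all_algebra.

Set Implicit Arguments.
Unset Strict Implicit.
Unset Printing Implicit Defensive.

Import Order.TTheory GRing.Theory Num.Theory.
Local Open Scope ring_scope.

(* The real scalars are an arbitrary real closed field.  A graph on n vertices
   is an adjacency relation e on 'I_n; vertex v_(i+1) is i : 'I_n. *)

Section MoorePenrose.
Variable R : realFieldType.

Definition penrose m n (A : 'M[R]_(m, n)) (X : 'M[R]_(n, m)) : bool :=
  [&& A *m X *m A == A, X *m A *m X == X,
      (A *m X)^T == A *m X & (X *m A)^T == X *m A].

Lemma penrose_uniq m n (A : 'M[R]_(m, n)) (X Y : 'M[R]_(n, m)) :
  penrose A X -> penrose A Y -> X = Y.
Proof.
move=> /and4P[/eqP AXA /eqP XAX /eqP AXt /eqP XAt].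
move=> /and4P[/eqP AYA /eqP YAY /eqP AYt /eqP YAt].
have AXY : A *m X = A *m Y.
  by rewrite -AXt -{1}AYA -mulmxA trmx_mul AXt AYt mulmxA AXA.
have XYA : X *m A = Y *m A.
  have XYe : X *m A = (X *m A) *m (Y *m A) by rewrite -{1}AYA !mulmxA.
  by rewrite -XAt XYe trmx_mul XAt YAt -mulmxA (mulmxA A) AXA.
by rewrite -XAX -mulmxA AXY mulmxA XYA YAY.
Qed.

Lemma mulmx_tr_eq0 n (v : 'rV[R]_n) : v *m v^T = 0 -> v = 0.
Proof.
move=> /matrixP/(_ 0 0); rewrite !mxE => v0; apply/rowP => i; rewrite mxE.
have /psumr_eq0P/(_ v0 i isT) : forall j, true -> 0 <= v 0 j * v^T j 0.
  by move=> j _; rewrite mxE -expr2 sqr_ge0.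
by move/eqP; rewrite mxE mulf_eq0 orbb => /eqP.
Qed.

Lemma row_free_gram_unit m n (F : 'M[R]_(m, n)) :
  row_free F -> F *m F^T \in unitmx.
Proof.
move=> freeF; rewrite -row_free_unit -kermx_eq0; apply/rowV0P => v.
move=> /sub_kermxP vFF; apply: (row_free_inj freeF); rewrite mul0mx.
by apply: mulmx_tr_eq0; rewrite trmx_mul mulmxA -(mulmxA v) vFF mul0mx.
Qed.

Lemma penrose_full_rank m r n (C : 'M[R]_(m, r)) (F : 'M[R]_(r, n)) :
  row_full C -> row_free F -> exists X : 'M[R]_(n, m), penrose (C *m F) X.
Proof.
move=> fullC freeF; set P := F *m F^T; set Q := C^T *m C.
have uP : P \in unitmx by exact: row_free_gram_unit.
have uQ : Q \in unitmx.
  rewrite /Q -[X in _ *m X]trmxK; apply: row_free_gram_unit.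
  by rewrite /row_free mxrank_tr.
have Pt : P^T = P by rewrite trmx_mul trmxK.
have Qt : Q^T = Q by rewrite trmx_mul trmxK.
pose X := F^T *m invmx P *m invmx Q *m C^T.
have AX : C *m F *m X = C *m invmx Q *m C^T.
  by rewrite /X !mulmxA -(mulmxA C F) -/P mulmxK.
have XA : X *m (C *m F) = F^T *m invmx P *m F.
  by rewrite /X !mulmxA -(mulmxA _ C^T) -/Q mulmxKV.
exists X; apply/and4P; split; apply/eqP.
- by rewrite AX !mulmxA -(mulmxA _ C^T) -/Q mulmxKV.
- by rewrite XA /X !mulmxA -(mulmxA _ F) -/P mulmxKV.
- by rewrite AX !trmx_mul trmxK trmx_inv Qt mulmxA.
- by rewrite XA !trmx_mul trmxK trmx_inv Pt mulmxA.
Qed.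

Lemma penrose_exists m n (A : 'M[R]_(m, n)) :
  exists X : 'M[R]_(n, m), penrose A X.
Proof.
have := penrose_full_rank (col_base_full A) (row_base_free A).
by rewrite mulmx_base.
Qed.

(* The Moore-Penrose inverse; not mathcomp's pinvmx, which is only a partial
   inverse depending on Gaussian elimination. *)
Definition mpinvmx m n (A : 'M[R]_(m, n)) : 'M[R]_(n, m) :=
  xchoose (penrose_exists A).

Lemma mpinvmxP m n (A : 'M[R]_(m, n)) : penrose A (mpinvmx A).
Proof. exact: xchooseP. Qed.

End MoorePenrose.

Section Graph.
Variables (R : realFieldType) (n : nat) (e : rel 'I_n).

Definition neighbors (i : 'I_n) : {set 'I_n} := [set j | e i j].

Definition deg (i : 'I_n) : nat := #|neighbors i|.

Definition connected_graph : Prop := forall i j, connect e i j.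

Definition adjacency_mx : 'M[R]_n := \matrix_(i, j) (e i j)%:R.

Definition degree_mx : 'M[R]_n := diag_mx (\row_i (deg i)%:R).

Definition laplacian : 'M[R]_n := degree_mx - adjacency_mx.

Definition resistance_mx : 'M[R]_n :=
  let Ld := mpinvmx laplacian in
  \matrix_(i, j) (Ld i i + Ld j j - 2 * Ld i j).

Definition resistance_degree (i : 'I_n) : R := \sum_j resistance_mx i j.

Definition resistance_regular : Prop :=
  forall i j, resistance_degree i = resistance_degree j.

End Graph.

Arguments adjacency_mx R {n} e.
Arguments degree_mx R {n} e.
Arguments laplacian R {n} e.
Arguments resistance_mx R {n} e.
Arguments resistance_degree R {n} e i.
Arguments resistance_regular R {n} e.

(* Main.v *)
Require Import Defs.
From HB Require Import structures.
From mathcomp Require Import all_boot all_order all_algebra.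

Set Implicit Arguments.
Unset Strict Implicit.
Unset Printing Implicit Defensive.

Import Order.TTheory GRing.Theory Num.Theory.
Local Open Scope ring_scope.

(** Write L for the Laplacian and M for its Moore-Penrose inverse.  As the graph
is connected, the kernel of L consists of the constant vectors
([laplacian_mul_eq0_const]), so L M is the orthogonal projector 1 - J/n, with J
the all-ones matrix ([laplacian_mul_mpinv]), and the rows of M sum to zero
([mpinv_laplacian_row_sum]).

Summing the resistances around vertex i gives R_i = n M_ii + tr M
([resistance_degreeE]), hence the graph is resistance regular if and only if
the diagonal of M is constant.  On the other hand, the diagonal entry of
L M = 1 - J/n at i reads
deg(i) M_ii - (sum of the M_ij over the neighbors j of i) = 1 - 1/n, so M_ii
equals 1/deg(i) (sum of the M_ij + 1 - 1/n) ([mpinv_laplacian_diag]).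
Finally the spectral decomposition of L identifies M_ij with the sum of the
s_ki s_kj / gamma_k ([mpinvmx_eigenE]).  The inverse of 0 is 0 by convention,
so this sum may run over all k; only gamma_n = 0 is needed to drop its last
term. *)

Section MoorePenroseSymmetric.
Variables (R : realFieldType) (n : nat).
Implicit Types (A U : 'M[R]_n) (d : 'rV[R]_n).

Lemma penrose_tr A X : penrose A X -> penrose A^T X^T.
Proof.
move=> /and4P[/eqP AXA /eqP XAX /eqP AXt /eqP XAt].
by rewrite /penrose -!trmx_mul !mulmxA AXA XAX !AXt !XAt !eqxx.
Qed.

Lemma mpinvmx_sym A : A^T = A -> (mpinvmx A)^T = mpinvmx A.
Proof.
move=> At; apply: (@penrose_uniq _ _ _ A); last exact: mpinvmxP.
by rewrite -{1}At; apply/penrose_tr/mpinvmxP.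
Qed.

Lemma mpinvmx_comm A : A^T = A -> A *m mpinvmx A = mpinvmx A *m A.
Proof.
move=> At; have /and4P[_ _ /eqP <- _] := mpinvmxP A.
by rewrite trmx_mul At mpinvmx_sym.
Qed.

(** The Moore-Penrose inverse has the same eigenvectors, with inverted
eigenvalues.  Zero eigenvalues need no special treatment, since [0^-1 = 0]. *)
Lemma mpinvmx_spectral U d : U^T *m U = 1%:M ->
  mpinvmx (U *m diag_mx d *m U^T) = U *m diag_mx (\row_k (d 0 k)^-1) *m U^T.
Proof.
move=> UU.
have mulD (x y : 'rV[R]_n) : (U *m diag_mx x *m U^T) *m (U *m diag_mx y *m U^T)
    = U *m diag_mx (\row_k (x 0 k * y 0 k)) *m U^T.
  by rewrite !mulmxA -(mulmxA _ U^T) UU mulmx1 -(mulmxA U) mulmx_diag.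
have trD (x : 'rV[R]_n) : (U *m diag_mx x *m U^T)^T = U *m diag_mx x *m U^T.
  by rewrite !trmx_mul trmxK tr_diag_mx mulmxA.
have mulVK (x : R) : x * x^-1 * x = x.
  by have [->|x0] := eqVneq x 0; rewrite ?mulr0 // mulfV // mul1r.
apply: penrose_uniq (mpinvmxP _) _; rewrite /penrose !mulD !trD !eqxx !andbT.
apply/andP; split; apply/eqP; congr (U *m diag_mx _ *m U^T); apply/rowP => k;
  rewrite !mxE ?mulVK //.
by rewrite -{2}[d 0 k]invrK mulVK.
Qed.

End MoorePenroseSymmetric.

Section LaplacianConnected.
Variables (R : realFieldType) (n : nat) (e : rel 'I_n).
Local Notation L := (laplacian R e).
Local Notation M := (mpinvmx (laplacian R e)).

Lemma laplacian_mulE p (X : 'M[R]_(n, p)) i k :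
  (L *m X) i k = (deg e i)%:R * X i k - \sum_(j in neighbors e i) X j k.
Proof.
rewrite /laplacian mulmxBl /degree_mx mul_diag_mx !mxE; congr (_ - _).
rewrite [RHS]big_mkcond /=; apply: eq_bigr => j _.
by rewrite !mxE inE; case: (e i j); rewrite ?mul1r ?mul0r.
Qed.

Lemma laplacian_mul_const1 p : L *m const_mx 1 = 0 :> 'M_(n, p).
Proof.
apply/matrixP => i k; rewrite laplacian_mulE !mxE mulr1.
by under eq_bigr do rewrite mxE; rewrite sumr_const subrr.
Qed.

(** Maximum principle: at a vertex where [x] is maximal, [L x = 0] forces all
neighbors to carry the same value, and so on along the paths of the graph. *)
Lemma laplacian_mul_eq0_const (x : 'cV[R]_n) :
  connected_graph e -> L *m x = 0 -> forall i j, x i 0 = x j 0.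
Proof.
move=> e_conn Lx i0.
have [m _ m_max] := @arg_maxP _ _ _ i0 xpredT (fun i => x i 0) isT.
have step i j : x i 0 = x m 0 -> e i j -> x j 0 = x m 0.
  move=> xi eij.
  have sum0 : \sum_(k in neighbors e i) (x m 0 - x k 0) = 0.
    rewrite sumrB sumr_const -/(deg e i) -mulr_natl -xi.
    by rewrite -laplacian_mulE Lx mxE.
  have /psumr_eq0P/(_ sum0 j) :
      forall k, k \in neighbors e i -> 0 <= x m 0 - x k 0.
    by move=> k _; rewrite subr_ge0; apply: m_max.
  by rewrite inE => /(_ eij) /eqP; rewrite subr_eq0 => /eqP.
have walk p : forall i, x i 0 = x m 0 -> path e i p -> x (last i p) 0 = x m 0.
  elim: p => //= k p IHp i xi /andP[eik].
  by apply: IHp; apply: step eik.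
have xm j : x j 0 = x m 0 by have /connectP[p m_p ->] := e_conn m j; apply: walk.
by move=> j; rewrite !xm.
Qed.

Hypothesis e_sym : symmetric e.

Lemma laplacian_sym : L^T = L.
Proof.
rewrite /laplacian linearB /= /degree_mx tr_diag_mx; congr (_ - _).
by apply/matrixP => i j; rewrite !mxE e_sym.
Qed.

Lemma mpinv_laplacian_row_sum i : \sum_j M i j = 0.
Proof.
have /and4P[_ /eqP MLM _ _] := mpinvmxP L.
have M1 : M *m const_mx 1 = 0 :> 'cV_n.
  rewrite -MLM -(mulmxA M) (mpinvmx_comm laplacian_sym).
  by rewrite -!mulmxA laplacian_mul_const1 !mulmx0.
transitivity ((M *m const_mx 1 : 'cV_n) i 0); last by rewrite M1 mxE.
by rewrite mxE; apply: eq_bigr => j _; rewrite mxE mulr1.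
Qed.

Lemma resistance_degreeE i : resistance_degree R e i = n%:R * M i i + \tr M.
Proof.
rewrite /resistance_degree; under eq_bigr do rewrite mxE.
rewrite sumrB big_split /= sumr_const card_ord -mulr_sumr.
by rewrite mpinv_laplacian_row_sum mulr0 subr0 mulr_natl.
Qed.

Hypothesis e_conn : connected_graph e.

Lemma laplacian_mul_mpinv : L *m M = 1%:M - const_mx n%:R^-1.
Proof.
have LM_comm := mpinvmx_comm laplacian_sym.
have /and4P[/eqP LML _ /eqP LMt _] := mpinvmxP L.
pose Q := 1%:M - L *m M.
have Qt : Q^T = Q by rewrite linearB /= trmx1 LMt.
have Qsym i j : Q i j = Q j i by rewrite -[in LHS]Qt [LHS]mxE.
have LQ : L *m Q = 0 by rewrite mulmxBr mulmx1 LM_comm mulmxA LML subrr.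
(* Each column of Q lies in the kernel of L, so Q, being symmetric, has all its
   entries equal; they equal 1/n because Q fixes the all-ones vector. *)
have Qcol i j k : Q i k = Q j k.
  have Lcol : L *m col k Q = 0 by rewrite colE mulmxA LQ mul0mx.
  by have := laplacian_mul_eq0_const e_conn Lcol i j; rewrite !mxE.
have Q1 : Q *m const_mx 1 = const_mx 1 :> 'cV_n.
  by rewrite mulmxBl mul1mx LM_comm -mulmxA laplacian_mul_const1 mulmx0 subr0.
suff QE : Q = const_mx n%:R^-1 by rewrite -QE subKr.
apply/matrixP => i j; rewrite [RHS]mxE.
have n_neq0 : n%:R != 0 :> R.
  by rewrite pnatr_eq0 -lt0n (leq_ltn_trans _ (ltn_ord i)).
apply: (mulfI n_neq0); rewrite mulfV //.
transitivity ((Q *m const_mx 1 : 'cV_n) i 0); last by rewrite Q1 mxE.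
rewrite [RHS]mxE (eq_bigr (fun=> Q i j)) => [|k _].
  by rewrite sumr_const card_ord mulr_natl.
by rewrite [const_mx _ _ _]mxE mulr1 [LHS]Qsym [RHS]Qsym; apply: Qcol.
Qed.

Lemma mpinv_laplacian_diag i : (1 < n)%N ->
  M i i = (deg e i)%:R^-1 *
    (\sum_(j in neighbors e i) M i j + 1 - n%:R^-1).
Proof.
move=> n_gt1.
have MC j k : M j k = M k j by rewrite -{1}(mpinvmx_sym laplacian_sym) mxE.
have LMii : (deg e i)%:R * M i i - \sum_(j in neighbors e i) M i j = 1 - n%:R^-1.
  under eq_bigr do rewrite MC.
  by rewrite -laplacian_mulE laplacian_mul_mpinv !mxE eqxx.
rewrite -addrA -LMii addrC subrK mulKf //.
(* A vertex without neighbors would give 0 = 1 - 1/n, that is, n = 1. *)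
apply/negP => /eqP deg0; move: (deg0) LMii => /eqP.
rewrite pnatr_eq0 cards_eq0 => /eqP ->; rewrite deg0 big_set0 mul0r subrr.
move/eqP; rewrite eq_sym subr_eq0 eq_sym invr_eq1 pnatr_eq1 => /eqP n1.
by rewrite n1 in n_gt1.
Qed.

End LaplacianConnected.

(** The [S k] are the columns of an orthogonal matrix that diagonalizes [A]; in
particular [A] is symmetric, although this is not assumed. *)
Lemma mpinvmx_eigenE (R : realFieldType) n (A : 'M[R]_n)
    (gamma : 'I_n -> R) (S : 'I_n -> 'cV[R]_n) :
  (forall i, A *m S i = gamma i *: S i) ->
  (forall i, (S i)^T *m S i = 1%:M) ->
  (forall i j, i != j -> (S i)^T *m S j = 0) ->
  forall i j, mpinvmx A i j = \sum_k (gamma k)^-1 * S k i 0 * S k j 0.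
Proof.
move=> S_eigen S_norm S_orth i j.
pose U : 'M[R]_n := \matrix_(i, k) S k i 0.
have UU : U^T *m U = 1%:M.
  apply/matrixP => k l; transitivity (((S k)^T *m S l) 0 0).
    by rewrite !mxE; apply: eq_bigr => m _; rewrite !mxE.
  have [->|kl] := eqVneq k l; first by rewrite S_norm !mxE !eqxx.
  by rewrite S_orth // !mxE (negPf kl).
have AU : A *m U = U *m diag_mx (\row_k gamma k).
  apply/matrixP => l k; rewrite mul_mx_diag !mxE.
  transitivity ((A *m S k) l 0); last by rewrite S_eigen mxE mulrC.
  by rewrite mxE; apply: eq_bigr => m _; rewrite !mxE.
have -> : A = U *m diag_mx (\row_k gamma k) *m U^T.
  by rewrite -AU -mulmxA (mulmx1C UU) mulmx1.
rewrite mpinvmx_spectral // mul_mx_diag !mxE; apply: eq_bigr => k _.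
by rewrite !mxE [S k i 0 * _]mulrC.
Qed.

Theorem theorem3p1 (R : rcfType) (n : nat) (n_ge2 : (2 <= n)%N)
    (e : rel 'I_n) (e_sym : symmetric e) (e_irr : irreflexive e)
    (e_conn : connected_graph e)
    (gamma : 'I_n -> R) (S : 'I_n -> 'cV[R]_n)
    (gamma_eigenvalues :
       char_poly (laplacian R e) = \prod_(i < n) ('X - (gamma i)%:P))
    (gamma_noninc : forall i j : 'I_n, (i <= j)%N -> gamma j <= gamma i)
    (gamma_last : forall i : 'I_n, i = n.-1 :> nat -> gamma i = 0)
    (S_eigen : forall i : 'I_n, laplacian R e *m S i = gamma i *: S i)
    (S_normalized : forall i : 'I_n, (S i)^T *m S i = 1%:M)
    (S_orthogonal : forall i j : 'I_n, i != j -> (S i)^T *m S j = 0) :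
  resistance_regular R e <->
  (exists c : R, forall i : 'I_n,
     (deg e i)%:R^-1 *
       (\sum_(j in neighbors e i)
           (\sum_(k < n | (k < n.-1)%N) (gamma k)^-1 * S k i 0 * S k j 0)
        + 1 - n%:R^-1) = c).
Proof.
pose M := mpinvmx (laplacian R e).
have sumE i : \sum_(j in neighbors e i)
    (\sum_(k < n | (k < n.-1)%N) (gamma k)^-1 * S k i 0 * S k j 0) =
    \sum_(j in neighbors e i) M i j.
  apply: eq_bigr => j _.
  rewrite /M (mpinvmx_eigenE S_eigen S_normalized S_orthogonal) big_mkcond /=.
  apply: eq_bigr => k _; case: ifPn => // k_last.
  (* The remaining index is the last one, whose eigenvalue is 0. *)
  rewrite gamma_last ?invr0 ?mul0r //.
  apply/eqP; rewrite eqn_leq [(n.-1 <= k)%N]leqNgt k_last andbT.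
  by rewrite -ltnS prednK ?ltn_ord // ltnW.
have n_neq0 : n%:R != 0 :> R by rewrite pnatr_eq0 -lt0n ltnW.
split=> [reg|[c diag_c] i j].
  exists (M (Ordinal n_ge2) (Ordinal n_ge2)) => i.
  rewrite sumE -mpinv_laplacian_diag //.
  have := reg i (Ordinal n_ge2); rewrite !resistance_degreeE //.
  by move=> /addIr /(mulfI n_neq0).
have Mc k : M k k = c by rewrite -(diag_c k) sumE -mpinv_laplacian_diag.
by rewrite !resistance_degreeE // -/M !Mc.
Qed.
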